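(* Let $(\Omega,\mathcal F,\mathbb P)$ be a standard atomless probability space and $\mathcal X=L^\infty(\Omega,\mathcal F,\mathbb P)$. For $c:\mathbb R\to\mathbb R$ strictly increasing and continuous, let $\rho_c:\mathcal X\to\mathbb R$, $\rho_c(X)=c^{-1}(\mathbb E(c(X)))$. The only translation invariant maps of the form $\rho_c$, with $c:\mathbb R\to\mathbb R$ strictly increasing and continuous, are the entropic risk measures; that is, a map $\rho:\mathcal X\to\mathbb R$ is both translation invariant and of the form $\rho=\rho_c$ for some strictly increasing continuous $c:\mathbb R\to\mathbb R$ if and only if there is $\beta\in\mathbb R$ such that $\rho=\rho^{ent}_\beta$, where $$\rho^{ent}_{\beta}(X)=\begin{cases}\frac1\beta\ln(\mathbb E(e^{\beta X})) & \text{if }\beta\neq 0,\\ \mathbb E(X) & \text{if }\beta=0.\end{cases}$$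
   Context: A map $\rho:\mathcal X\to\mathbb R$ is translation invariant if $\rho(X+m)=\rho(X)+m$ for all $X\in\mathcal X$ and all constants $m\in\mathbb R$. For $X\in L^\infty$ and $c$ strictly increasing and continuous, $\mathbb E(c(X))$ lies in the range of $c$, so $\rho_c(X)$ (the certainty equivalent of $X$) is well defined. *)

(* Defs.v *)
From HB Require Import structures.
From mathcomp Require Import all_boot all_order all_algebra.
From mathcomp Require Import all_classical all_reals all_analysis.
From mathcomp Require Import ess_sup_inf measurable_realfun.

Set Implicit Arguments.
Unset Strict Implicit.
Unset Printing Implicit Defensive.
Import Order.TTheory GRing.Theory Num.Theory numFieldNormedType.Exports.
Local Open Scope classical_set_scope.
Local Open Scope ring_scope.

Section standard_space.
Context d (T : measurableType d) (R : realType).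

Definition atomless (P : probability T R) : Prop :=
  forall A, measurable A -> (0 < P A)%E ->
    exists B, [/\ measurable B, B `<=` A, (0 < P B)%E & (P B < P A)%E].

(* Measurability up to a negligible set, i.e. with respect to the completion of
   [mu]: isomorphism mod 0 then does not depend on whether the sigma-algebras
   at hand (e.g. Borel versus Lebesgue) are complete. *)
Definition mod0_measure_preserving d' (T' : measurableType d')
    (mu : {measure set T -> \bar R}) (nu : {measure set T' -> \bar R})
    (D : set T) (f : T -> T') : Prop :=
  forall E, measurable E ->
    exists F, [/\ measurable F, mu.-negligible ((D `&` f @^-1` E) `+` F) &
                  mu F = nu E].

End standard_space.

Definition isomorphic_mod0 d d' (T : measurableType d) (T' : measurableType d')
    (R : realType) (mu : {measure set T -> \bar R})
    (nu : {measure set T' -> \bar R}) : Prop :=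
  exists (D : set T) (D' : set T') (f : T -> T') (g : T' -> T),
    [/\ mu.-negligible (~` D) /\ nu.-negligible (~` D'),
        {homo f : x / D x >-> D' x} /\ {homo g : y / D' y >-> D y},
        {in D, cancel f g} /\ {in D', cancel g f},
        mod0_measure_preserving mu nu D f &
        mod0_measure_preserving nu mu D' g].

(* Lebesgue-Rokhlin: isomorphic mod 0 to the disjoint union of an interval
   [0, a] carrying Lebesgue measure and of countably many atoms (possibly none),
   here placed at the points -1, -2, ... of the real line. *)
Definition standard d (T : measurableType d) (R : realType)
    (P : probability T R) : Prop :=
  exists (a : R) (w : nat -> R) (nu : probability (measurableTypeR R) R),
    [/\ 0 <= a, (forall n, 0 <= w n),
        (forall A : set (measurableTypeR R), measurable A ->
           nu A = (lebesgue_measure (A `&` `[0%R, a]) +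
             \sum_(0 <= n <oo) (w n)%:E * dirac (- n.+1%:R : R)%R A)%E) &
        isomorphic_mod0 P nu].

Definition Linfty d (T : measurableType d) (R : realType)
    (P : probability T R) : Type := LspaceType P (leey (1%R%:E : \bar R)).

Section Linfty_theory.
Context d (T : measurableType d) (R : realType) (P : probability T R).
Local Open Scope quotient_scope.

Lemma finite_norm_ae_eq (f g : T -> R) : f = g %[ae P] ->
  finite_norm P +oo f -> finite_norm P +oo g.
Proof.
rewrite /finite_norm unlock => fg; congr (_ < _)%E; case: ifPn => // _.
by apply: eq_ess_sup; apply: filterS fg => x /(_ I) /= ->.
Qed.

Section class_of_function.
Variables (f : T -> measurableTypeR R) (mf : measurable_fun [set: T] f).
Variable ff : finite_norm P +oo f.

#[local] HB.instance Definition _ :=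
  @isMeasurableFun.Build _ _ T (measurableTypeR R) f mf.

Let class : {mfun_ P, T >-> measurableTypeR R} :=
  \pi_{mfun_ P, T >-> measurableTypeR R} (f : {mfun T >-> measurableTypeR R}).

Let class_ae : (class : T -> R) = f %[ae P].
Proof.
have : repr class = f %[mod {mfun_ P, T >-> measurableTypeR R}].
  by rewrite reprK.
by move/eqmodP => /= /asboolP.
Qed.

Let class_finite : finite_norm P +oo class.
Proof. by apply: finite_norm_ae_eq ff; exact: ae_eq_sym class_ae. Qed.

#[local] HB.instance Definition _ := isFinLebesgue.Build d T R P +oo%E
  (leey (1%R%:E : \bar R)) class class_finite.

Definition Linfty_class : Linfty P := class.

Lemma Linfty_class_ae : (Linfty_class : T -> R) = f %[ae P].
Proof. exact: class_ae. Qed.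

End class_of_function.

Section translation.
Variables (X : Linfty P) (m : R).
Let Xm : T -> R := fun w => X w + m.

Let measurable_X : measurable_fun [set: T] (X : T -> R).
Proof.
exact: measurable_funPT (repr (X : {mfun_ P, T >-> measurableTypeR R})).
Qed.

Let measurable_Xm : measurable_fun [set: T] Xm.
Proof. exact: measurable_funD. Qed.

Let finite_Xm : finite_norm P +oo Xm.
Proof.
apply: le_lt_trans.
  exact: (eminkowski P measurable_X (measurable_cst m) (leey _)).
rewrite lte_add_pinfty//; first exact: Lebesgue_finite.
rewrite unlock /Lnorm; case: ifPn => // P0.
by rewrite (_ : _ \o _ = cst `|m|%:E)// ess_sup_cst// ltry.
Qed.

(* The class of [X + m]; the library has no addition on [LspaceType]. *)
Definition Linfty_addc : Linfty P := Linfty_class measurable_Xm finite_Xm.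

Lemma Linfty_addc_ae : (Linfty_addc : T -> R) = (fun w => X w + m) %[ae P].
Proof. exact: Linfty_class_ae. Qed.

End translation.
End Linfty_theory.

Section maps_on_Linfty.
Context d (T : measurableType d) (R : realType) (P : probability T R).
Implicit Types (rho : Linfty P -> R) (X : Linfty P).

Definition translation_invariant rho : Prop :=
  forall X (m : R), rho (Linfty_addc X m) = rho X + m.

(* For [c] strictly increasing and continuous the expectation lies in the range
   of [c], so that [pinv] is the inverse function there. *)
Definition certainty_equivalent (c : R -> R) X : R :=
  pinv [set: R] c (fine 'E_P[c \o X]).

Definition entropic_risk (beta : R) X : R :=
  if beta == 0 then fine 'E_P[X]
  else beta^-1 * ln (fine 'E_P[fun w => expR (beta * X w)]).

End maps_on_Linfty.

(* Main.v *)
(* Given translation invariance, test rho_c on the variables taking two values,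
   one of them on a fixed event of probability p with 0 < p < 1. For every m this
   gives: if c z = p c x + (1 - p) c y then c (z + m) = p c (x + m) +
   (1 - p) c (y + m). Hence c (. + m) is an affine function of c, by the maximum
   principle; a single p suffices. Normalising f = c - c 0, the relation
   f (x + m) = a m * f x + f m is symmetric in x and m, so that a m = 1 + k * f m
   for a constant k. If k = 0 then f is additive, hence linear; otherwise a is
   multiplicative, hence an exponential, and c is an affine function of it.
   The certainty equivalent does not change when c is composed with an affine
   bijection. *)
Require Import Defs.
From mathcomp Require Import all_boot all_order all_algebra.
From mathcomp Require Import all_classical all_reals all_analysis.
From mathcomp Require Import ess_sup_inf measurable_realfun ring lra.

Set Implicit Arguments.
Unset Strict Implicit.
Unset Printing Implicit Defensive.
Import Order.TTheory GRing.Theory Num.Theory numFieldNormedType.Exports.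
Local Open Scope classical_set_scope.
Local Open Scope ring_scope.

(** * Functions affine along a weighted quasi-arithmetic mean *)

Section weighted_affine.
Context (R : realType) (p : R) (c : R -> R).
Hypotheses (p_in01 : 0 < p < 1).
Hypotheses (c_incr : {homo c : x y / x < y}) (c_cont : continuous c).

(** Jensen's equation with the single weight [p] for [h] read in the coordinate [c]; the relational
    form avoids the inverse of [c]. *)
Definition weighted_affine (h : R -> R) :=
  forall x y z, c z = p * c x + (1 - p) * c y ->
    h z = p * h x + (1 - p) * h y.

Lemma weighted_mean_exists x y :
  exists z, c z = p * c x + (1 - p) * c y.
Proof.
have [p_gt0 p_lt1] := andP p_in01.
have cW a b : a <= b -> c a <= c b by exact: (ltW_homo c_incr).
have [xy|/ltW yx] := leP x y.
  have := cW _ _ xy => cxy.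
  have [||z _ cz] := @IVT R c x y (p * c x + (1 - p) * c y) xy.
  - exact: continuous_subspaceT.
  - by rewrite (min_idPl cxy) (max_idPr cxy); apply/andP; split; nra.
  - by exists z.
have := cW _ _ yx => cyx.
have [||z _ cz] := @IVT R c y x (p * c x + (1 - p) * c y) yx.
- exact: continuous_subspaceT.
- by rewrite (min_idPl cyx) (max_idPr cyx); apply/andP; split; nra.
- by exists z.
Qed.

(* At a point where a positive maximum M is attained, [w] can be written as a
   weighted mean of an endpoint, where [h] vanishes, and of a point of the
   interval, whence M <= max p (1 - p) * M. *)
Lemma weighted_affine_le0 h u v w : continuous h -> weighted_affine h ->
  h u = 0 -> h v = 0 -> u <= w <= v -> h w <= 0.
Proof.
move=> h_cont h_aff hu hv /andP[uw wv]; have [p_gt0 p_lt1] := andP p_in01.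
have cW a b : a <= b -> c a <= c b by exact: (ltW_homo c_incr).
have [|m /[!in_itv]/= /andP[um mv] max_m] := EVT_max (le_trans uw wv) (f := h).
  exact: continuous_subspaceT.
have /le_trans : h w <= h m by apply: max_m; rewrite in_itv/= uw.
apply; rewrite leNgt; apply/negP => hm.
have cum := cW _ _ um; have cmv := cW _ _ mv.
(* The comparison decides which endpoint to use: solving for the second point [z] gives [z <= v] in
   the first case and [u <= z] in the other. *)
have [le_pu|lt_pu] := leP (p * (c m - c u)) ((1 - p) * (c v - c m)).
  have [||z /[!in_itv]/= /andP[mz zv] cz] :=
      @IVT R c m v ((c m - p * c u) / (1 - p)) mv.
  - exact: continuous_subspaceT.
  - rewrite (min_idPl cmv) (max_idPr cmv) ler_pdivlMr ?ler_pdivrMr ?subr_gt0//.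
    by apply/andP; split; nra.
  have /h_aff : c m = p * c u + (1 - p) * c z by rewrite cz; field; lra.
  have : h z <= h m by apply: max_m; rewrite in_itv/= zv (le_trans um).
  by rewrite hu; nra.
have [||z /[!in_itv]/= /andP[uz zm] cz] :=
    @IVT R c u m ((c m - (1 - p) * c v) / p) um.
- exact: continuous_subspaceT.
- rewrite (min_idPl cum) (max_idPr cum) ler_pdivlMr// ler_pdivrMr//.
  by apply/andP; split; nra.
have /h_aff : c m = p * c z + (1 - p) * c v by rewrite cz; field; lra.
have : h z <= h m by apply: max_m; rewrite in_itv/= uz (le_trans zm).
by rewrite hv; nra.
Qed.

(** The deviation of [h] from its chord in the coordinate [c] is again weighted affine and vanishes
    at [u] and [v]; the maximum principle applies to it and to its negative. *)
Lemma weighted_affine_collinear h u w v : continuous h -> weighted_affine h ->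
  u <= w <= v -> (h w - h u) * (c v - c u) = (h v - h u) * (c w - c u).
Proof.
move=> h_cont h_aff uwv.
pose k s x := s * ((h x - h u) * (c v - c u) - (h v - h u) * (c x - c u)).
have k_cont s : continuous (k s).
  move=> x; rewrite /k; apply: cvgM; first exact: cvg_cst.
  apply: cvgB; apply: cvgM; try exact: cvg_cst.
    by apply: cvgB; [exact: h_cont|exact: cvg_cst].
  by apply: cvgB; [exact: c_cont|exact: cvg_cst].
have k_aff s : weighted_affine (k s).
  by move=> x y z cz; rewrite /k cz (h_aff _ _ _ cz); ring.
have k_le0 s : k s w <= 0.
  by apply: (weighted_affine_le0 (k_cont s) (k_aff s) _ _ uwv); rewrite /k; ring.
by have := k_le0 1; have := k_le0 (-1); rewrite /k; lra.
Qed.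

Lemma weighted_affineP h : continuous h -> weighted_affine h ->
  exists a b, forall x, h x = a * c x + b.
Proof.
move=> h_cont h_aff.
have c01 : c 0 < c 1 by apply: c_incr.
exists ((h 1 - h 0) / (c 1 - c 0)), (h 0 - (h 1 - h 0) / (c 1 - c 0) * c 0) => x.
suff E : (h x - h 0) * (c 1 - c 0) = (h 1 - h 0) * (c x - c 0).
  apply: (@mulIf _ (c 1 - c 0)); first lra.
  rewrite -[LHS](subrK (h 0 * (c 1 - c 0))) -mulrBl E; field; lra.
(* Collinearity wants the middle point between the other two, so 0, 1 and [x] are sorted first. *)
have col u w v := @weighted_affine_collinear h u w v h_cont h_aff.
have [x0|/ltW x0] := leP x 0.
  by have := col x 0 1; rewrite x0 ler01 => /(_ isT); lra.
have [x1|/ltW x1] := leP x 1; first by apply: col; rewrite x0.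
by have := col 0 1 x; rewrite x1 ler01 => /(_ isT); lra.
Qed.

End weighted_affine.

(** * Functional equations and their exponential solutions *)

Lemma additive_continuous_linear (R : realType) (f : R -> R) :
  {morph f : x y / x + y} -> continuous f -> forall x, f x = f 1 * x.
Proof.
move=> fD f_cont.
(* With the identity as coordinate and weight 1/2, additivity gives midpoint affinity, so the
   previous section applies. *)
have f_aff : weighted_affine 2^-1 id f.
  move=> x y z /= ->.
  have half t : f (2^-1 * t) = 2^-1 * f t.
    have -> : f t = f (2^-1 * t) + f (2^-1 * t) by rewrite -fD; congr f; field.
    by field.
  have -> : 1 - 2^-1 = 2^-1 :> R by field.
  by rewrite fD !half.
have [|||a [b fE]] := @weighted_affineP R 2^-1 id _ _ _ f f_cont f_aff.
- by apply/andP; split; lra.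
- by [].
- by move=> x; exact: cvg_id.
have : f 0 = 0 by apply: (@addrI _ (f 0)); rewrite -fD !addr0.
by move=> f0 x; have := fE 0; rewrite f0 !fE /= mulr0 add0r => <-; ring.
Qed.

(** Normal form, up to affine maps, of the utilities behind the entropic risk measures. It decreases
    for [beta < 0], so the factor placed in front of it is only asked to be nonzero. *)
Definition exp_utility (R : realType) (beta x : R) : R :=
  if beta == 0 then x else expR (beta * x).

Lemma translation_affine_exp_utility (R : realType) (c : R -> R) :
  {homo c : x y / x < y} -> continuous c ->
  (forall m, exists a b, forall x, c (x + m) = a * c x + b) ->
  exists beta A B, A != 0 /\ forall x, c x = A * exp_utility beta x + B.
Proof.
move=> c_incr c_cont /choice[a /choice[b cD]].
pose f x := c x - c 0.
have f_cont : continuous f.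
  by move=> x; apply: cvgB; [exact: c_cont|exact: cvg_cst].
have f0 : f 0 = 0 by rewrite /f subrr.
have f1 : 0 < f 1 by rewrite subr_gt0 c_incr.
(* Subtracting the instance of [cD] at 0 eliminates [b m]. *)
have fD x m : f (x + m) = a m * f x + f m.
  by have := cD m 0; rewrite /f add0r cD => ->; ring.
pose k := (a 1 - 1) / f 1.
have aE m : a m = 1 + k * f m.
  (* Expand [f (1 + m)] in both orders and compare. *)
  have := fD 1 m; rewrite addrC fD => E.
  by apply: (@mulIf _ (f 1)); [lra|rewrite /k mulrDl mulrAC divfK; lra].
have [k0|k0] := eqVneq k 0.
  have flin : forall x, f x = f 1 * x.
    apply: additive_continuous_linear f_cont => x y.
    by rewrite fD aE k0; ring.
  exists 0, (f 1), (c 0); split=> [|x]; first lra.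
  by rewrite /exp_utility eqxx -flin /f subrK.
have aD x y : a (x + y) = a x * a y by rewrite !aE fD aE; ring.
have a0 : a 0 = 1 by rewrite aE f0; ring.
have a_gt0 x : 0 < a x.
  have aN : a x * a (- x) = 1 by rewrite -aD subrr.
  (* [a x] is the square of [a (x / 2)], which cannot vanish because [a x] is invertible by [aN]. *)
  have -> : x = x / 2 + x / 2 by field.
  rewrite aD -expr2 exprn_even_gt0//=.
  apply: contra_eq_neq (aD (x / 2) (x / 2)) => ->.
  have -> : x / 2 + x / 2 = x by field.
  by rewrite mul0r; apply: contra_eq_neq aN => ->; rewrite mul0r; lra.
have a_cont : continuous a.
  have -> : a = fun x => 1 + k * f x by apply/funext => x; rewrite aE.
  move=> x; apply: cvgD; first exact: cvg_cst.
  by apply: cvgM; [exact: cvg_cst|exact: f_cont].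
pose l x := ln (a x).
have l_lin : forall x, l x = l 1 * x.
  apply: additive_continuous_linear => [x y|x]; first by rewrite /l aD lnM ?posrE.
  by apply: continuous_comp; [exact: a_cont|exact: continuous_ln].
have aexp x : a x = expR (l 1 * x) by rewrite -l_lin lnK ?posrE.
have l1 : l 1 != 0.
  apply: contra_neq k0 => l1.
  by rewrite /k aexp l1 mul0r expR0 subrr mul0r.
(* These coefficients come from solving [a x = 1 + k * f x] for [c x = f x + c 0]. *)
exists (l 1), k^-1, (c 0 - k^-1); split=> [|x]; first exact: invr_neq0.
rewrite /exp_utility (negPf l1) -aexp aE.
by rewrite mulrDr mulKf// /f; ring.
Qed.

Lemma exp_utility_inj (R : realType) (beta : R) : injective (exp_utility beta).
Proof.
rewrite /exp_utility => x y; case: eqVneq => // b0 /expR_inj; exact: mulfI.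
Qed.

Lemma exp_utility_continuous (R : realType) (beta : R) :
  continuous (exp_utility beta).
Proof.
rewrite /exp_utility; case: eqVneq => _ x; first exact: cvg_id.
apply: (@continuous_comp _ _ _ ( *%R beta) expR); last exact: continuous_expR.
exact: mulrl_continuous.
Qed.

Lemma pinv_eq (T : pointedType) (U : Type) (f : T -> U) x y :
  injective f -> f x = y -> pinv setT f y = x.
Proof. by move=> f_inj <-; apply: pinvKV; rewrite ?inE// => ? ? _ _ /f_inj. Qed.

(** * Expectations, certainty equivalents and entropic risks of bounded variables *)

Section expectation.
Context d (T : measurableType d) (R : realType) (P : probability T R).
Implicit Types (X : Linfty P) (f g : T -> R).

Lemma Linfty_measurable X : measurable_fun [set: T] (X : T -> R).
Proof.
exact: measurable_funPT (repr (X : {mfun_ P, T >-> measurableTypeR R})).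
Qed.

Lemma Linfty_ae_bounded X :
  exists2 M : R, 0 <= M & \forall w \ae P, `|X w| <= M.
Proof.
have := Lebesgue_finite (s := X).
rewrite /finite_norm unlock /Lnorm; case: ifPn => [_|]; last first.
  (* The norm at [+oo] is an essential supremum only on a space of positive measure, hence the case
     to exclude. *)
  have PT : (0 < P setT)%E by rewrite probability_setT lte01.
  by move=> /negP[]; exact: PT.
move=> /(@ess_supr_bounded _ _ _ P (Num.norm \o X))[M XM].
exists `|M| => //.
by apply: filterS XM => w /= /le_trans; apply; rewrite ler_norm.
Qed.

Lemma bounded_finite_norm f (M : R) :
  (forall w, `|f w| <= M) -> finite_norm P +oo f.
Proof.
move=> fM; rewrite /finite_norm unlock /Lnorm; case: ifPn => // _.
apply: (@le_lt_trans _ _ M%:E); last exact: ltry.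
by apply/ess_supP/nearW => w; rewrite /= lee_fin.
Qed.

Lemma ae_bounded_integrable f (M : R) : 0 <= M -> measurable_fun setT f ->
  (\forall w \ae P, `|f w| <= M) -> P.-integrable setT (EFin \o f).
Proof.
move=> M0 mf fM; apply/integrableP; split; first exact/measurable_EFinP.
apply: (@le_lt_trans _ _ (\int[P]_w (cst M%:E) w)%E); last first.
  by rewrite integral_cst//= probability_setT mule1 ltry.
apply: ae_ge0_le_integral => //.
- by apply: measurableT_comp => //; exact/measurable_EFinP.
- by apply: filterS fM => w fMw _; rewrite /= lee_fin.
Qed.

Lemma ae_eq_expectation f g : measurable_fun setT f -> measurable_fun setT g ->
  f = g %[ae P] -> ('E_P[f] = 'E_P[g])%E.
Proof.
move=> mf mg fg; rewrite unlock; apply: ae_eq_integral => //.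
- exact/measurable_EFinP.
- exact/measurable_EFinP.
- by apply: filterS fg => w /(_ I) /= ->.
Qed.

Lemma fine_expectation_affine f (a b : R) : P.-integrable setT (EFin \o f) ->
  fine 'E_P[fun w => a * f w + b] = a * fine 'E_P[f] + b.
Proof.
move=> If; have Lf : f \in Lfun P 1 by exact/Lfun1_integrable.
have Lc : cst b \in Lfun P 1 by exact: Lfun_cst.
have -> : (fun w => a * f w + b) = (a \o* f) \+ cst b.
  by apply/funext => w /=; rewrite mulrC.
rewrite expectationD//; last exact: Lfun_scale.
rewrite expectationZl// expectation_cst fineD//; last first.
  by rewrite fin_numM// expectation_fin_num.
by rewrite fineM// expectation_fin_num.
Qed.

Lemma exp_utility_integrable (beta : R) X :
  P.-integrable setT (EFin \o (exp_utility beta \o X)).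
Proof.
have [M M0 XM] := Linfty_ae_bounded X.
have mX := Linfty_measurable X.
(* One constant dominates both cases of [exp_utility]. *)
apply: (@ae_bounded_integrable _ (M + expR (`|beta| * M))).
- by rewrite addr_ge0 ?expR_ge0.
- apply: measurableT_comp => //.
  by apply: continuous_measurable_fun; exact: exp_utility_continuous.
- apply: filterS XM => w XM; rewrite /exp_utility /=; case: eqVneq => _.
    by rewrite (le_trans XM)// lerDl expR_ge0.
  rewrite ger0_norm ?expR_ge0//.
  apply: (@le_trans _ _ (expR (`|beta| * M))); last by rewrite lerDr.
  by rewrite ler_expR (le_trans (ler_norm _))// normrM ler_wpM2l.
Qed.

(** An almost sure bound [M] on [X] keeps the integrand above [expR (- (|beta| * M))]. Positivity is
    what makes [ln] a genuine logarithm in [entropic_risk]. *)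
Lemma expectation_expR_gt0 (beta : R) X :
  0 < fine 'E_P[fun w => expR (beta * X w)].
Proof.
have [->|b0] := eqVneq beta 0.
  under [X in 'E_P[X]%E]eq_fun do rewrite mul0r expR0.
  by rewrite (expectation_cst P 1).
have [M M0 XM] := Linfty_ae_bounded X.
have Iexp := exp_utility_integrable beta X.
rewrite /exp_utility (negPf b0) in Iexp.
apply: (@lt_le_trans _ _ (expR (- (`|beta| * M)))); first exact: expR_gt0.
rewrite -lee_fin fineK; last first.
  by apply: expectation_fin_num; exact/Lfun1_integrable.
rewrite -(expectation_cst P); apply: expectation_le => //.
- by apply/measurable_EFinP; case/integrableP : Iexp.
- by move=> w; rewrite expR_ge0.
- apply: filterS XM => w XM /=; rewrite ler_expR lerNl.
  by rewrite (le_trans (ler_norm _))// normrN normrM ler_wpM2l.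
Qed.

(** As [c] is injective, it suffices to evaluate it at the entropic risk; linearity of the
    expectation takes [a] and [b] outside. Both directions of the theorem rest on this. *)
Lemma certainty_equivalent_exp_utility (c : R -> R) (beta a b : R) :
  a != 0 -> (forall x, c x = a * exp_utility beta x + b) ->
  certainty_equivalent (P := P) c = entropic_risk beta.
Proof.
move=> a0 cE; apply/funext => X; apply: pinv_eq => [x y|].
  by rewrite !cE => /addIr /(mulfI a0) /exp_utility_inj.
have -> : c \o X = fun w => a * (exp_utility beta \o X) w + b.
  by apply/funext => w /=; rewrite cE.
rewrite (fine_expectation_affine _ _ (exp_utility_integrable _ _)) cE.
congr (a * _ + b); rewrite /entropic_risk /exp_utility.
case: eqVneq => // b0.
by rewrite mulVKf// lnK// posrE expectation_expR_gt0.
Qed.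

(** The values of [Linfty_addc X m] are known only almost everywhere, which the expectation does not
    see. The factor [expR (beta * m)] then leaves the expectation, and [ln] turns it into a
    summand. *)
Lemma entropic_risk_translation_invariant (beta : R) :
  translation_invariant (P := P) (entropic_risk beta).
Proof.
move=> X m.
have mX := Linfty_measurable X; have mXm := Linfty_measurable (Linfty_addc X m).
have XmE := Linfty_addc_ae X m.
have Iexp := exp_utility_integrable beta X.
rewrite /entropic_risk /exp_utility in Iexp *.
case: eqVneq Iexp => [_|b0] Iexp.
  rewrite (ae_eq_expectation _ _ XmE)//; last exact: measurable_funD.
  under [X in 'E_P[X]%E]eq_fun => w do rewrite -[X w]mul1r.
  by rewrite fine_expectation_affine ?mul1r.
have -> : ('E_P[fun w => expR (beta * Linfty_addc X m w)] =
           'E_P[(fun w => expR (beta * m) * expR (beta * X w) + 0)%R])%E.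
  apply: ae_eq_expectation.
  - by apply: measurableT_comp => //; exact: measurable_funM.
  - apply: measurable_funD => //; apply: measurable_funM => //.
    by apply: measurableT_comp => //; exact: measurable_funM.
  - apply: filterS XmE => w /(_ I) Xw _.
    by rewrite Xw addr0 -expRD; congr expR; ring.
rewrite fine_expectation_affine// addr0 lnM ?posrE ?expR_gt0//; last first.
  exact: expectation_expR_gt0.
by rewrite expRK mulrDr mulKf// addrC.
Qed.

(** * Two-valued test variables and the equation they impose on [c] *)

Section two_valued.
Variables (B : set T) (mB : measurable B) (x y : R).

Let two_valued (s t : R) (w : T) : R := (s - t) * \1_B w + t.

Let measurable_two_valued s t : measurable_fun setT (two_valued s t).
Proof.
by apply: measurable_funD => //; apply: measurable_funM.
Qed.

Let finite_two_valued : finite_norm P +oo (two_valued x y).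
Proof.
apply: (@bounded_finite_norm _ (`|x| + `|y|)) => w.
rewrite /two_valued indicE; case: (w \in B); rewrite ?mulr1 ?subrK ?lerDl//.
by rewrite mulr0 add0r lerDr.
Qed.

Definition Linfty_two_valued : Linfty P :=
  Linfty_class (measurable_two_valued x y) finite_two_valued.

(** Shifting by [m] and applying [c] yields, almost everywhere, another two-valued variable on [B],
    affine in [\1_B]. *)
Lemma certainty_equivalent_two_valued (c : R -> R) (m : R) :
  continuous c ->
  certainty_equivalent c (Linfty_addc Linfty_two_valued m) =
  pinv setT c (fine (P B) * c (x + m) + (1 - fine (P B)) * c (y + m)).
Proof.
move=> c_cont; rewrite /certainty_equivalent; congr pinv.
rewrite (@ae_eq_expectation _ (two_valued (c (x + m)) (c (y + m)))).
- rewrite fine_expectation_affine; last exact: integrable_indic.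
  by rewrite expectation_indic//; ring.
- apply: measurableT_comp; last exact: Linfty_measurable.
  exact: continuous_measurable_fun.
- exact: measurable_two_valued.
- have XE := Linfty_class_ae (measurable_two_valued x y) finite_two_valued.
  apply: filterS2 (Linfty_addc_ae Linfty_two_valued m) XE.
  move=> w /(_ I) /= -> /(_ I) -> _; rewrite /two_valued indicE.
  by case: (w \in B); rewrite ?mulr1 ?mulr0 ?subrK ?add0r.
Qed.

End two_valued.

Lemma atomless_two_valued : atomless P ->
  exists2 B, measurable B & 0 < fine (P B) < 1.
Proof.
move=> /(_ setT measurableT); rewrite probability_setT => /(_ lte01).
move=> [B [mB _ B_gt0 B_lt1]]; exists B => //.
by rewrite -!lte_fin fineK ?B_gt0// fin_num_measure.
Qed.

(** Lets the formula for shifted two-valued variables also serve the unshifted one, as the shift by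
    0. *)
Lemma certainty_equivalent_addc0 X (c : R -> R) : continuous c ->
  certainty_equivalent c (Linfty_addc X 0) = certainty_equivalent c X.
Proof.
move=> c_cont; rewrite /certainty_equivalent; congr (pinv _ _ (fine _)).
have mc := continuous_measurable_fun c_cont.
apply: ae_eq_expectation.
- by apply: measurableT_comp => //; exact: Linfty_measurable.
- by apply: measurableT_comp => //; exact: Linfty_measurable.
- by apply: filterS (Linfty_addc_ae X 0) => w /(_ I) /= -> _; rewrite addr0.
Qed.

Lemma translation_invariant_affine (c : R -> R) : atomless P ->
  {homo c : x y / x < y} -> continuous c ->
  translation_invariant (P := P) (certainty_equivalent c) ->
  forall m, exists a b, forall x, c (x + m) = a * c x + b.
Proof.
move=> /atomless_two_valued[B mB PB] c_incr c_cont c_transl m.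
have c_inj : injective c by apply: inc_inj; exact: le_mono.
apply: (weighted_affineP PB c_incr c_cont) => [x|x y z cz].
  apply: (@continuous_comp _ _ _ (+%R^~ m) c); last exact: c_cont.
  by apply: cvgD; [exact: cvg_id|exact: cvg_cst].
have := c_transl (Linfty_two_valued mB x y) m.
rewrite -(certainty_equivalent_addc0 (Linfty_two_valued mB x y))//.
rewrite !certainty_equivalent_two_valued// !addr0 -cz (pinv_eq c_inj erefl).
(* [t] is the certainty equivalent of the shifted variable and [z] that of the original, so
   invariance reads [t = z + m]. *)
have [t ct] := weighted_mean_exists PB c_incr c_cont (x + m) (y + m).
by rewrite -ct (pinv_eq c_inj erefl) => ->.
Qed.

End expectation.

Theorem theorem3p1 (R : realType) (d : measure_display)
    (T : measurableType d) (P : probability T R)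
    (standardP : standard P) (atomlessP : atomless P)
    (rho : Linfty P -> R) :
  (translation_invariant rho /\
   exists c : R -> R,
     [/\ {homo c : x y / x < y}, continuous c &
         rho = certainty_equivalent c]) <->
  exists beta : R, rho = entropic_risk beta.
Proof.
split=> [[rho_transl [c [c_incr c_cont rhoE]]]|[beta ->]].
  rewrite rhoE in rho_transl.
  have cD := translation_invariant_affine atomlessP c_incr c_cont rho_transl.
  have [beta [a [b [a0 cE]]]] := translation_affine_exp_utility c_incr c_cont cD.
  by exists beta; rewrite rhoE; exact: certainty_equivalent_exp_utility a0 cE.
split; first exact: entropic_risk_translation_invariant.
(* Dividing by [beta] makes the exponential utility increasing for either sign of [beta]. *)
pose a : R := if beta == 0 then 1 else beta^-1.
have a0 : a != 0.
  rewrite /a; case: (eqVneq beta) => [_|].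
    exact: oner_neq0.
  exact: invr_neq0.
exists (fun x => a * exp_utility beta x + 0); split; last first.
- by rewrite (certainty_equivalent_exp_utility _ a0 (fun=> erefl)).
- move=> x; apply: cvgD; last exact: cvg_cst.
  by apply: cvgM; [exact: cvg_cst|exact: exp_utility_continuous].
move=> x y xy; rewrite !addr0 /a /exp_utility; case: eqVneq => [_|b0].
  by rewrite !mul1r.
have [b_lt0|b_gt0] := ltP beta 0.
  by rewrite ltr_nM2l ?invr_lt0// ltr_expR ltr_nM2l.
have {}b_gt0 : 0 < beta by rewrite lt_neqAle eq_sym b0.
by rewrite ltr_pM2l ?invr_gt0// ltr_expR ltr_pM2l.
Qed.
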